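(* Let $U^n$, $n=2,\dots,N$, be the solution of the variable step-size BDF2 scheme $\bar\partial_B^2U^n+AU^n+BU^n=f^n$ ($n=2,\dots,N$) with starting approximations $U^0,U^1$, where $f:[0,T]\to H$. Let $r_{\max}\le R$ with $1<R<R_0=\sqrt2+1\approx 2.414$. If there exists a constant $c_1\in(0,1)$ such that $k_{\max}$ satisfies $$(4+2\sqrt2)\,\gamma^2k_{\max}\le c_1<1,$$ then, for any $n\ge2$ (with $n\le N$), $$k_n|\bar\partial U^n|^2+\|U\|^2_{l^2(t^2,t^n;H,H)}+\|U\|^2_{l^\infty(t^2,t^n;V)}\le C_1\Big(\sum_{j=2}^nk_j|f^j|^2+k_2s_2|\bar\partial U^1|^2+\|U^1\|^2\Big),$$ where $$C_1=\frac{4+2\sqrt2}{1-c_1}\exp\Big(\frac{4+2\sqrt2}{1-c_1}\sum_{j=2}^n\gamma^2(t^j)k_j\Big)\le\frac{4+2\sqrt2}{1-c_1}\exp\Big(\frac{4+2\sqrt2}{1-c_1}\gamma^2t^n\Big).$$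
   Context: Let $(H,(\cdot,\cdot))$ be a Hilbert space with norm $|\cdot|$, and $A:D(A)\to H$ a positive definite, self-adjoint, linear operator with $D(A)$ dense in $H$. Let $V=D(A^{1/2})$ with norm $\|v\|=|A^{1/2}v|=(Av,v)^{1/2}$, and let $V^*$ be its dual, $V\subset H\subset V^*$, with norm $\|v\|_*=|A^{-1/2}v|$; $(\cdot,\cdot)$ also denotes the duality pairing between $V^*$ and $V$. $B$ is a linear operator with $|Bu|\le\gamma(t)\|u\|$ for all $u\in V$, $t\in J:=(0,T]$, where $\gamma:J\to\mathbb R$ is a smooth nonnegative function, and (without argument) $\gamma:=\max_{t\in J}\gamma(t)$. The underlying problem is $u'(t)+Au(t)+Bu(t)=f(t)$, $t\in J$, $u(0)=u^0$. Partition: $N\ge2$, $0=t^0<t^1<\dots<t^N=T$, $k_n=t^n-t^{n-1}$, $r_n=k_n/k_{n-1}$ and $s_n=r_n/(1+r_n)=k_n/(k_n+k_{n-1})$ for $n\ge2$; $k_{\max}=\max_{2\le n\le N}k_n$, $r_{\max}=\max_{2\le n\le N}r_n$; $f^n=f(t^n)$. Difference operators: $\bar\partial U^n=(U^n-U^{n-1})/k_n$ and $\bar\partial_B^2U^n=(1+s_n)\bar\partial U^n-s_n\bar\partial U^{n-1}$. The scheme is understood in variational form: $(\bar\partial_B^2U^n,v)+(AU^n,v)+(BU^n,v)=(f^n,v)$ for all $v\in V$, with $U^n\in V$; starting approximations $U^0\in H$, $U^1\in V$ are given. Norms: $\|U\|_{l^\infty(t^{n_1},t^{n_2};V)}=\max_{n_1\le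 j\le n_2}\|U^j\|$ and $\|U\|_{l^2(t^{n_1},t^{n_2};H,H)}=\big(\sum_{j=n_1}^{n_2-1}k_js_j|\bar\partial U^j|^2\big)^{1/2}$ (empty sums are $0$). *)

(* Defs.v *)
From HB Require Import structures.
From mathcomp Require Import all_boot all_order all_algebra.
From mathcomp Require Import all_classical all_reals all_analysis.

Set Implicit Arguments.
Unset Strict Implicit.
Unset Printing Implicit Defensive.

Import Order.TTheory GRing.Theory Num.Theory.
Import numFieldNormedType.Exports.

Local Open Scope classical_set_scope.
Local Open Scope ring_scope.

(* [D] is only the part of the real line where [g] is relevant; it need not be
   open, so smoothness means having a smooth extension to an open superset. *)
Definition smooth_on (R : realType) (D : set R) (g : R -> R) : Prop :=
  exists (O : set R) (h : R -> R),
    [/\ open O, D `<=` O, (forall n x, O x -> derivable (derive1n n h) x 1)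
      & forall x, D x -> g x = h x].

(* A linear operator defined on the subspace [odom]; the values of the
   underlying total function outside [odom] are irrelevant. *)
Record linop (R : realType) (H : lmodType R) := LinOp {
  odom : set H;
  ofun :> H -> H;
  odom0 : odom 0;
  odomP : forall (a : R) x y, odom x -> odom y -> odom (a *: x + y);
  ofunP : forall (a : R) x y, odom x -> odom y ->
    ofun (a *: x + y) = a *: ofun x + ofun y
}.

(* [H] is a real Hilbert space: its complete norm comes from [ip]. *)
Definition hilbert_ip (R : realType) (H : completeNormedModType R)
    (ip : {dot H for idfun}) : Prop :=
  forall x : H, `|x| ^+ 2 = ip x x.

(* [A] is densely defined and its graph is that of its adjoint: [y] is in the
   domain of the adjoint, with value [z], iff (A x, y) = (x, z) on [odom A]. *)
Definition self_adjoint (R : realType) (H : completeNormedModType R)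
    (ip : {dot H for idfun}) (A : linop H) : Prop :=
  dense (odom A) /\
  forall y z, (odom A y /\ A y = z) <->
              (forall x, odom A x -> ip (A x) y = ip x z).

Definition positive_definite (R : realType) (H : completeNormedModType R)
    (ip : {dot H for idfun}) (A : linop H) : Prop :=
  forall v, odom A v -> v != 0 -> 0 < ip (A v) v.

(* [S] is A^{1/2}, the unique nonnegative self-adjoint operator whose square,
   with its natural domain, is [A]. *)
Definition is_sqrt (R : realType) (H : completeNormedModType R)
    (ip : {dot H for idfun}) (A S : linop H) : Prop :=
  [/\ self_adjoint ip S,
      (forall v, odom S v -> 0 <= ip (S v) v),
      (forall v, odom A v <-> (odom S v /\ odom S (S v)))
    & (forall v, odom A v -> A v = S (S v))].

(* With S = A^{1/2} and V = odom S: the norm of V, and the duality pairing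
   (A u, v) of A u in V^* with v in V, for u in V.  The latter is the extension
   by continuity of ip (A u) v from odom A to V, see [pairingAE]. *)
Definition normV (R : realType) (H : completeNormedModType R) (S : linop H)
  (v : H) : R := `|S v|.

Definition pairingA (R : realType) (H : completeNormedModType R)
    (ip : {dot H for idfun}) (S : linop H) (u v : H) : R :=
  ip (S u) (S v).

Lemma pairingAE (R : realType) (H : completeNormedModType R)
    (ip : {dot H for idfun}) (A S : linop H) (u v : H) :
  is_sqrt ip A S -> odom A u -> odom S v -> pairingA ip S u v = ip (A u) v.
Proof.
move=> [[_ sa] _ dA AE] uA vS.
have [uS SuS] := (dA u).1 uA.
by rewrite /pairingA AE// (proj1 (sa v (S v)) _ _ SuS).
Qed.

Definition partition_of (R : realType) (N : nat) (T : R) (t : nat -> R) : Prop :=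
  [/\ t 0%N = 0, t N = T & forall n, (n < N)%N -> t n < t n.+1].

(* k_n for n >= 1; r_n and s_n for n >= 2. *)
Definition kstep (R : realType) (t : nat -> R) (n : nat) : R := t n - t n.-1.

Definition rstep (R : realType) (t : nat -> R) (n : nat) : R :=
  kstep t n / kstep t n.-1.

Definition sstep (R : realType) (t : nat -> R) (n : nat) : R :=
  rstep t n / (1 + rstep t n).

(* The neutral element 0 of these maxima is harmless: all terms are >= 0. *)
Definition kmax (R : realType) (t : nat -> R) (N : nat) : R :=
  \big[Num.max/0]_(2 <= n < N.+1) kstep t n.

Definition rmax (R : realType) (t : nat -> R) (N : nat) : R :=
  \big[Num.max/0]_(2 <= n < N.+1) rstep t n.

Definition dbar (R : realType) (H : lmodType R) (t : nat -> R) (U : nat -> H)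
  (n : nat) : H := (kstep t n)^-1 *: (U n - U n.-1).

Definition dbar2 (R : realType) (H : lmodType R) (t : nat -> R) (U : nat -> H)
  (n : nat) : H :=
  (1 + sstep t n) *: dbar t U n - sstep t n *: dbar t U n.-1.

Definition bdf2_scheme (R : realType) (H : completeNormedModType R)
    (ip : {dot H for idfun}) (S B : linop H) (N : nat) (t : nat -> R)
    (f : R -> H) (U : nat -> H) : Prop :=
  forall n, (2 <= n <= N)%N ->
    odom S (U n) /\
    forall v, odom S v ->
      ip (dbar2 t U n) v + pairingA ip S (U n) v + ip (B (U n)) v
      = ip (f (t n)) v.

Definition norm_linfV (R : realType) (H : completeNormedModType R)
    (S : linop H) (U : nat -> H) (n1 n2 : nat) : R :=
  \big[Num.max/0]_(n1 <= j < n2.+1) normV S (U j).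

Definition norm_l2HH (R : realType) (H : completeNormedModType R)
    (t : nat -> R) (U : nat -> H) (n1 n2 : nat) : R :=
  Num.sqrt (\sum_(n1 <= j < n2) kstep t j * sstep t j * `|dbar t U j| ^+ 2).

Definition C1 (R : realType) (gamma : R -> R) (t : nat -> R) (c1 : R)
    (n : nat) : R :=
  let c := (4 + 2 * Num.sqrt 2) / (1 - c1) in
  c * expR (c * \sum_(2 <= j < n.+1) gamma (t j) ^+ 2 * kstep t j).

(* Main.v *)
Require Import Defs.
From mathcomp Require Import all_boot all_order all_algebra.
From mathcomp Require Import all_classical all_reals all_analysis.
From mathcomp Require Import ring lra.

Set Implicit Arguments.
Unset Strict Implicit.
Unset Printing Implicit Defensive.

Import Order.TTheory GRing.Theory Num.Theory.
Import numFieldNormedType.Exports.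

Local Open Scope classical_set_scope.
Local Open Scope ring_scope.

(* Testing the scheme with v = U^j - U^{j-1} and estimating the mixed term by
     2 (d_{j-1}, d_j) <= 2 |d_j|^2 + |d_{j-1}|^2 / 2,   d_j = dbar U^j,
   rather than by the balanced Young inequality, leaves in front of every
   k_j |d_j|^2 the coefficient kappa = 3/2 - sqrt 2 / 4, because
   k_{j+1} s_{j+1} = k_j r^2/(1+r) <= (1 + sqrt 2/2) k_j for r <= 1 + sqrt 2.
   As s_j <= sqrt 2/2, the energy inequality controls the l^2-norm with the
   amount kappa - sqrt 2/2 = 3 (2 - sqrt 2)/4 of dissipation left to absorb f
   and BU, at the price of 2/3 of 4 + 2 sqrt 2 in front of
   sum_j k_j (|f^j|^2 + |BU^j|^2).  Absorbing twice as much dissipation bounds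
   every ||U^j||^2, hence their maximum, at the price of the remaining third.
   Adding the two bounds and applying Gronwall's lemma gives the theorem. *)

(** * Inner product identities and Young's inequality *)

Section InnerProduct.
Variables (R : realType) (H : completeNormedModType R) (ip : {dot H for idfun}).
Hypothesis H_hilbert : hilbert_ip ip.

Lemma ipC (x y : H) : ip x y = ip y x.
Proof. by rewrite hermC/= expr0 mul1r. Qed.

Lemma ipBl (x y z : H) : ip (x - y) z = ip x z - ip y z.
Proof. by rewrite linearBl. Qed.

Lemma ipBr (x y z : H) : ip z (x - y) = ip z x - ip z y.
Proof. by rewrite linearBr. Qed.

Lemma ipZl (a : R) (x z : H) : ip (a *: x) z = a * ip x z.
Proof. by rewrite linearZl_LR. Qed.

Lemma ipZr (a : R) (x z : H) : ip z (a *: x) = a * ip z x.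
Proof. by rewrite linearZr_LR. Qed.

Lemma normB_sqr (x y : H) :
  `|x - y| ^+ 2 = `|x| ^+ 2 - 2 * ip x y + `|y| ^+ 2.
Proof. rewrite !H_hilbert ipBl !ipBr (ipC y x); ring. Qed.

(** Expand [0 <= |mu x - y|^2] and divide by [mu]. *)
Lemma ip_young (mu : R) (x y : H) : 0 < mu ->
  2 * ip x y <= mu * `|x| ^+ 2 + mu^-1 * `|y| ^+ 2.
Proof.
move=> mu0.
have := sqr_ge0 `|mu *: x - y|.
rewrite normB_sqr ipZl normrZ gtr0_norm// exprMn => h.
rewrite -(ler_pM2l mu0) mulrDr (mulrA mu mu^-1) divff ?gt_eqF// mul1r.
by lra.
Qed.

Lemma normB_sqr_le (x y : H) :
  `|x - y| ^+ 2 <= 2 * (`|x| ^+ 2 + `|y| ^+ 2).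
Proof.
have := ip_young x (- y) ltr01.
rewrite normB_sqr linearNr/= normrN invr1 !mul1r; lra.
Qed.

End InnerProduct.

(** * Energy inequality: one step and its summation *)

Lemma linopB (R : realType) (H : lmodType R) (L : linop H) (x y : H) :
  odom L x -> odom L y -> odom L (x - y) /\ L (x - y) = L x - L y.
Proof.
move=> xL yL; have := odomP (-1) yL xL; have := ofunP (-1) yL xL.
by rewrite !scaleN1r !(addrC (- _)).
Qed.

(** In twice the tested scheme, the mixed term costs [2 k s |d_j|^2], exactly what the factor
    [1 + s] provides beyond [2 k |d_j|^2]. Hence the coefficient [2 - lam] does not depend on the
    step ratio; [lam] is the dissipation spent on [f - B U]. *)
Lemma bdf2_step (R : realType) (H : completeNormedModType R)
    (ip : {dot H for idfun}) (S B : linop H) (N : nat) (t : nat -> R)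
    (f : R -> H) (U : nat -> H) (lam : R) (j : nat) :
  hilbert_ip ip -> bdf2_scheme ip S B N t f U -> (2 <= j <= N)%N ->
  odom S (U j.-1) -> 0 < kstep t j -> 0 <= sstep t j -> 0 < lam ->
  (2 - lam) * (kstep t j * `|dbar t U j| ^+ 2) + normV S (U j) ^+ 2
  <= normV S (U j.-1) ^+ 2
     + kstep t j * sstep t j / 2 * `|dbar t U j.-1| ^+ 2
     + 2 / lam * (kstep t j * (`|f (t j)| ^+ 2 + `|B (U j)| ^+ 2)).
Proof.
move=> Hip sch jN U'S k0 s0 lam0.
have [US /(_ (U j - U j.-1))] := sch j jN.
have [dS SE] := linopB US U'S.
move=> /(_ dS); rewrite /pairingA SE.
have -> : U j - U j.-1 = kstep t j *: dbar t U j.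
  by rewrite /dbar scalerA divff ?gt_eqF// scale1r.
rewrite /dbar2 /normV.
move: (kstep t j) k0 (sstep t j) s0 => k k0 s s0.
move: (dbar t U j) (dbar t U j.-1) (f (t j)) (B (U j)) (S (U j)) (S (U j.-1)).
move=> d d' F b v v'.
rewrite ipBl ipBr !ipZl !ipZr -!Hip.
have := normB_sqr Hip v v'; have := sqr_ge0 `|v - v'|.
have half0 : 0 < 2^-1 :> R by rewrite invr_gt0.
have := ip_young Hip d' d half0; rewrite invrK.
have := ip_young Hip d (F - b) lam0; rewrite ipBr ![ip d _]ipC.
have := normB_sqr_le Hip F b.
move=> h1 h2 h3 h4 h5 h6.
(* With these weights the goal is a linear combination of the facts at hand; [|v - v'|^2] from the
   polarised term [2 (v, v - v')] is discarded. *)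
have {h1}h1 := ler_wpM2l (ltW (divr_gt0 k0 lam0)) h1.
have {h2}h2 := ler_wpM2l (ltW k0) h2.
have {h3}h3 := ler_wpM2l (mulr_ge0 (ltW k0) s0) h3.
lra.
Qed.

(** The [e j] telescope, and the [D j] gained at one step pays for the [beta * D j] carried into the
    next; only the last one, [D n], keeps its full weight. *)
Lemma energy_sum (R : realFieldType) (D e c : nat -> R) (I lam beta : R)
    (n : nat) : (2 <= n)%N ->
  (2 - lam) * D 2%N + e 2%N <= I + c 2%N ->
  (forall j, (2 <= j < n)%N ->
     (2 - lam) * D j.+1 + e j.+1 <= e j + beta * D j + c j.+1) ->
  (2 - lam) * D n + (2 - beta - lam) * (\sum_(2 <= j < n) D j) + e n
  <= I + \sum_(2 <= j < n.+1) c j.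
Proof.
move=> n2 h2; elim: n n2 => // n IHn.
rewrite leq_eqVlt ltnS => /predU1P[<-|n2] step.
  by rewrite big_geq// big_nat1; lra.
have lift j : (2 <= j < n -> 2 <= j < n.+1)%N by move=> /andP[-> /ltnW].
have := IHn n2 (fun j jn => step j (lift j jn)).
have := step n; rewrite n2 ltnSn => /(_ isT).
by rewrite !big_nat_recr//= 1?ltnW//; lra.
Qed.

(** The sum bounding [e j] includes the index [j] itself. Moving that term to the left uses
    [a j <= c < 1] and costs a factor [1 / (1 - a j) <= exp (a j / (1 - c))]. The induction carries
    the majorant [F + sum], not [e]. *)
Lemma discrete_gronwall (R : realType) (a e : nat -> R) (F c : R) (m n : nat) :
  (m <= n)%N -> 0 <= F -> c < 1 ->
  (forall j, (m <= j < n)%N -> 0 <= a j <= c) ->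
  (forall j, (m <= j < n)%N -> e j <= F + \sum_(m <= i < j.+1) a i * e i) ->
  F + \sum_(m <= j < n) a j * e j
  <= F * expR ((1 - c)^-1 * \sum_(m <= j < n) a j).
Proof.
move=> mn F0 c1; elim: n mn => [|n IHn].
  by rewrite leqn0 => /eqP-> _ _; rewrite !big_geq// mulr0 expR0 mulr1 addr0.
rewrite leq_eqVlt ltnS => /predU1P[<- _ _|mn ac eF].
  by rewrite !big_geq// mulr0 expR0 mulr1 addr0.
have lift j : (m <= j < n -> m <= j < n.+1)%N by move=> /andP[-> /ltnW].
have {IHn} :=
  IHn mn (fun j jn => ac j (lift j jn)) (fun j jn => eF j (lift j jn)).
have := eF n; rewrite mn ltnSn => /(_ isT).
have := ac n; rewrite mn ltnSn => /(_ isT) /andP[an0 anc].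
rewrite !big_nat_recr//= mulrDr expRD mulrA.
set y := \sum_(m <= j < n) a j * e j.
set E := expR (_ * \sum_(_ <= _ < _) _) => enF yE.
have c1' : 0 < 1 - c by lra.
have growth : 1 <= (1 - a n) * expR ((1 - c)^-1 * a n).
  have h : 1 + (1 - a n)^-1 * a n <= expR ((1 - c)^-1 * a n).
    apply: le_trans (expR_ge1Dx _) _; rewrite ler_expR.
    by apply: ler_wpM2r => //; rewrite lef_pV2 ?posrE; lra.
  have a1 : 0 < 1 - a n by lra.
  apply: le_trans (ler_wpM2l (ltW a1) h).
  by rewrite mulrDr mulrA divff ?gt_eqF// mul1r; lra.
have a1 : 0 < 1 - a n by lra.
(* For [Y = F + y], [enF] gives [(1 - a n) (Y + a n * e n) <= Y], and [Y <= F * E]. *)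
rewrite -(ler_pM2l a1).
have FE0 : 0 <= F * E by rewrite mulr_ge0// expR_ge0.
have h1 := ler_wpM2l FE0 growth.
have h2 := ler_wpM2l an0 enF.
lra.
Qed.

(** Both [r / (1 + r)] and [r^2 / (1 + r)] increase with [r]; the bounds are their values at
    [1 + sqrt 2]. *)
Lemma ratio_bounds (R : rcfType) (r : R) : 0 < r <= Num.sqrt 2 + 1 ->
  [/\ 0 <= r / (1 + r), r / (1 + r) <= Num.sqrt 2 / 2
    & r * (r / (1 + r)) <= 1 + Num.sqrt 2 / 2].
Proof.
set q := Num.sqrt 2 => /andP[r0 rq].
have q0 : 0 <= q by exact: sqrtr_ge0.
have qq : q * q = 2 by rewrite -expr2 sqr_sqrtr.
have r1 : 0 < 1 + r by lra.
rewrite mulrA !ler_pdivrMr// divr_ge0 ?(ltW r0) ?(ltW r1)//.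
by split => //; nra.
Qed.

Lemma ler_sum_natr (R : numDomainType) (F : nat -> R) (m n p : nat) :
  (n <= p)%N -> (forall j, (m <= j < p)%N -> 0 <= F j) ->
  \sum_(m <= j < n) F j <= \sum_(m <= j < p) F j.
Proof.
move=> np F0; have [mn|nm] := leqP m n; last first.
  by rewrite big_geq ?(ltnW nm)// big_nat sumr_ge0.
rewrite [leRHS](big_cat_nat mn np)/= lerDl big_nat sumr_ge0// => j /andP[nj jp].
by rewrite F0// (leq_trans mn).
Qed.

Lemma partition_mono (R : realType) (N : nat) (T : R) (t : nat -> R) (i j : nat) :
  partition_of N T t -> (i <= j <= N)%N -> t i <= t j.
Proof.
move=> [_ _ tS] /andP[ij]; elim: j ij => [|j IHj].
  by rewrite leqn0 => /eqP->.
rewrite leq_eqVlt ltnS => /predU1P[->//|ij] jN.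
exact: le_trans (IHj ij (ltnW jN)) (ltW (tS _ jN)).
Qed.

Lemma kstep_gt0 (R : realType) (N : nat) (T : R) (t : nat -> R) (j : nat) :
  partition_of N T t -> (1 <= j <= N)%N -> 0 < kstep t j.
Proof. by move=> [_ _ tS] /andP[]; case: j => // j _ jN; rewrite subr_gt0 tS. Qed.

Lemma bigmax_sqr_le (R : rcfType) (F : nat -> R) (Z : R) (m n : nat) :
  0 <= Z -> (forall j, (m <= j < n)%N -> 0 <= F j) ->
  (forall j, (m <= j < n)%N -> F j ^+ 2 <= Z) ->
  (\big[Num.max/0]_(m <= j < n) F j) ^+ 2 <= Z.
Proof.
move=> Z0 F0 FZ; rewrite big_nat.
have [M0 MZ] : 0 <= \big[Num.max/0]_(m <= j < n | (m <= j < n)%N) F j /\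
    \big[Num.max/0]_(m <= j < n | (m <= j < n)%N) F j <= Num.sqrt Z.
  split; last first.
    apply: bigmax_le => [|j jmn]; first exact: sqrtr_ge0.
    by rewrite -(ger0_norm (F0 j jmn)) -sqrtr_sqr ler_wsqrtr// FZ.
  by elim/big_rec: _ => // j x jmn x0; rewrite le_max x0 orbT.
by rewrite -(sqr_sqrtr Z0) ler_sqr ?nnegrE ?sqrtr_ge0.
Qed.

Theorem theorem3p1 (R : realType) (H : completeNormedModType R)
    (ip : {dot H for idfun}) (H_hilbert : hilbert_ip ip)
    (A S B : linop H)
    (A_sa : self_adjoint ip A) (A_pd : positive_definite ip A)
    (S_sqrtA : is_sqrt ip A S)
    (T : R) (gamma : R -> R) (gmax : R)
    (gamma_smooth : smooth_on `]0, T] gamma)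
    (gamma_ge0 : forall x, 0 < x <= T -> 0 <= gamma x)
    (gmax_attained : exists2 x, 0 < x <= T & gamma x = gmax)
    (gmax_ub : forall x, 0 < x <= T -> gamma x <= gmax)
    (V_sub_B : odom S `<=` odom B)
    (B_bound : forall u x, odom S u -> 0 < x <= T ->
       `|B u| <= gamma x * normV S u)
    (N : nat) (N_ge2 : (2 <= N)%N) (t : nat -> R)
    (t_part : partition_of N T t)
    (f : R -> H) (U : nat -> H)
    (U1V : odom S (U 1%N))
    (U_scheme : bdf2_scheme ip S B N t f U)
    (rho : R) (rho_bounds : 1 < rho < Num.sqrt 2 + 1)
    (rmax_le : rmax t N <= rho)
    (c1 : R) (c1_bounds : 0 < c1 < 1)
    (kmax_small : (4 + 2 * Num.sqrt 2) * gmax ^+ 2 * kmax t N <= c1)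
    (n : nat) (n_range : (2 <= n <= N)%N) :
  kstep t n * `|dbar t U n| ^+ 2 + norm_l2HH t U 2 n ^+ 2
    + norm_linfV S U 2 n ^+ 2
  <= C1 gamma t c1 n *
     (\sum_(2 <= j < n.+1) kstep t j * `|f (t j)| ^+ 2
      + kstep t 2 * sstep t 2 * `|dbar t U 1| ^+ 2
      + normV S (U 1%N) ^+ 2)
  /\
  C1 gamma t c1 n
  <= (4 + 2 * Num.sqrt 2) / (1 - c1)
     * expR ((4 + 2 * Num.sqrt 2) / (1 - c1) * (gmax ^+ 2 * t n)).

Proof.

(* Bounds on [sqrt 2], the nodes and the step ratios *)
set q := Num.sqrt 2 in rho_bounds kmax_small *.
have q0 : 0 <= q by exact: sqrtr_ge0.
have qq : q * q = 2 by rewrite -expr2 sqr_sqrtr.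
have q2 : q < 3 / 2 by nra.
have q1 : 7 / 5 < q by nra.
have k_gt0 j : (1 <= j <= N)%N -> 0 < kstep t j by exact: (kstep_gt0 t_part).
(* The bounds on [gamma] hold on []0, T]] only; positivity of the nodes comes from [k_1 > 0]. *)
have tT j : (1 <= j <= N)%N -> 0 < t j <= T.
  move=> jN; have [t0 tN _] := t_part; have /andP[j1 jN'] := jN.
  rewrite -tN (partition_mono t_part) ?jN' ?leqnn// andbT.
  have := k_gt0 1%N; rewrite (leq_trans j1 jN')/kstep/= t0 => /(_ isT).
  by have := partition_mono t_part jN; lra.
have le1 j : (2 <= j <= N -> 1 <= j <= N)%N by move=> /andP[/ltnW-> ->].
have le1' j : (2 <= j <= N -> 1 <= j.-1 <= N)%N.
  by case: j => [|[|j]]//= /ltnW->.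
have rbnd j : (2 <= j <= N)%N -> 0 < rstep t j <= q + 1.
  move=> jN; rewrite (divr_gt0 (k_gt0 _ (le1 j jN)) (k_gt0 _ (le1' j jN))) /=.
  apply: (@le_trans _ _ rho); last by lra.
  apply: le_trans rmax_le; apply: le_bigmax_seq => //.
  by rewrite mem_index_iota.
have sbnd j : (2 <= j <= N)%N ->
    [/\ 0 <= sstep t j, sstep t j <= q / 2 & rstep t j * sstep t j <= 1 + q / 2].
  by move=> jN; exact: ratio_bounds (rbnd j jN).
have gmaxE j : (1 <= j <= N)%N -> gamma (t j) ^+ 2 <= gmax ^+ 2.
  move=> /tT tj; have g0 := gamma_ge0 _ tj; have gm := gmax_ub _ tj.
  by rewrite ler_sqr ?nnegrE// (le_trans g0 gm).
have UV j : (1 <= j <= N)%N -> odom S (U j).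
  by case: j => [|[|j]]// jN; have [] := U_scheme j.+2 jN.

(* Energy inequality along the scheme *)
pose D j := kstep t j * `|dbar t U j| ^+ 2.
pose e j := normV S (U j) ^+ 2.
pose c j := kstep t j * (`|f (t j)| ^+ 2 + gamma (t j) ^+ 2 * e j).
pose I0 := kstep t 2 * sstep t 2 * `|dbar t U 1| ^+ 2.
have D0 j : (1 <= j <= N)%N -> 0 <= D j.
  by move=> /k_gt0 kj; rewrite mulr_ge0 ?(ltW kj)// sqr_ge0.
have e0 j : 0 <= e j by exact: sqr_ge0.
have c0 j : (1 <= j <= N)%N -> 0 <= c j.
  move=> /k_gt0 kj; rewrite mulr_ge0 ?(ltW kj)// addr_ge0 ?sqr_ge0//.
  by rewrite mulr_ge0 ?sqr_ge0.
have step lam j : 0 < lam -> (2 <= j <= N)%N ->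
    (2 - lam) * D j + e j <=
    e j.-1 + kstep t j * sstep t j / 2 * `|dbar t U j.-1| ^+ 2 + 2 / lam * c j.
  move=> lam0 jN; have [s0 _ _] := sbnd j jN.
  have kj := k_gt0 j (le1 j jN).
  apply: le_trans
    (bdf2_step H_hilbert U_scheme jN (UV _ (le1' j jN)) kj s0 lam0) _.
  rewrite lerD2l ler_wpM2l ?divr_ge0 ?(ltW lam0)// ler_wpM2l ?(ltW kj)// lerD2l.
  rewrite -exprMn ler_sqr ?nnegrE//; last first.
    exact: mulr_ge0 (gamma_ge0 _ (tT j (le1 j jN))) (normr_ge0 _).
  by apply: B_bound; [exact: UV (le1 j jN)|exact: tT (le1 j jN)].
have energy lam m : 0 < lam -> (2 <= m <= N)%N ->
    (2 - lam) * D m + (3 / 2 - q / 4 - lam) * (\sum_(2 <= j < m) D j) + e m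
    <= e 1%N + I0 / 2 + 2 / lam * \sum_(2 <= j < m.+1) c j.
  move=> lam0 /andP[m2 mN].
  have -> : 3 / 2 - q / 4 - lam = 2 - (1 + q / 2) / 2 - lam by field.
  rewrite [2 / lam * _]mulr_sumr; apply: energy_sum => //.
    (* The first mixed term involves [dbar t U 1] and is kept as the datum [I0 / 2]. *)
    by have := step _ 2%N lam0; rewrite N_ge2 /I0 => /(_ isT)/=; lra.
  move=> j /andP[j2 jm]; have jN : (2 <= j.+1 <= N)%N.
    by rewrite ltnS (ltnW j2) (leq_trans jm mN).
  apply: le_trans (step _ _ lam0 jN) _.
  rewrite lerD2r lerD2l /= /D.
  have [_ _ rs] := sbnd _ jN.
  have kj := k_gt0 j (le1' _ jN).
  have -> : kstep t j.+1 = kstep t j * rstep t j.+1.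
    by rewrite /rstep mulrC divfK// gt_eqF.
  rewrite [leRHS]mulrA ler_wpM2r ?sqr_ge0//.
  have := ler_wpM2l (ltW kj) rs; lra.
have sumc0 m : (2 <= m <= N)%N -> 0 <= \sum_(2 <= j < m.+1) c j.
  move=> /andP[_ mN]; rewrite big_nat sumr_ge0// => j /andP[j2 jm].
  by rewrite c0// (ltnW j2) (leq_trans _ mN).
have sumD0 m : (2 <= m <= N)%N -> 0 <= \sum_(2 <= j < m) D j.
  move=> /andP[_ mN]; rewrite big_nat sumr_ge0// => j /andP[j2 jm].
  by rewrite D0// (ltnW j2) (leq_trans (ltnW jm)).
have I00 : 0 <= I0.
  have n2 : (2 <= 2 <= N)%N by [].
  have [s0 _ _] := sbnd 2%N n2.
  by rewrite mulr_ge0 ?sqr_ge0// mulr_ge0// ltW// k_gt0// le1.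
pose cq := 4 + 2 * q.
have cq0 : 0 < cq by rewrite /cq; lra.
have emax m : (2 <= m <= N)%N ->
    e m <= e 1%N + I0 / 2 + cq / 3 * \sum_(2 <= j < m.+1) c j.
  (* As [(2 - q) (2 + q) = 2], this choice gives [2 / lam = cq / 3]; what remains of the dissipation
     is nonnegative and is dropped. *)
  move=> mN; have lam0 : 0 < 3 / 2 * (2 - q) by lra.
  have := energy _ _ lam0 mN.
  have -> : 2 / (3 / 2 * (2 - q)) = cq / 3.
    by rewrite -[RHS](mulfK (lt0r_neq0 lam0)); congr (_ / _); rewrite /cq; lra.
  have := mulr_ge0 (_ : 0 <= 2 - 3 / 2 * (2 - q)) (D0 m (le1 m mN)).
  have := mulr_ge0 (_ : 0 <= 3 / 2 - q / 4 - 3 / 2 * (2 - q)) (sumD0 m mN).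
  move=> /(_ ltac:(lra)) h1 /(_ ltac:(lra)) h2; lra.
have dissip m : (2 <= m <= N)%N ->
    D m + \sum_(2 <= j < m) kstep t j * sstep t j * `|dbar t U j| ^+ 2
    <= e 1%N + I0 / 2 + 2 * (cq / 3) * \sum_(2 <= j < m.+1) c j.
  (* This [lam] leaves exactly [q / 2], an upper bound of every [s_j], in front of the sum, and
     [2 - lam >= 1] in front of [D m]. *)
  move=> mN; have lam0 : 0 < 3 / 4 * (2 - q) by lra.
  have := energy _ _ lam0 mN.
  have -> : 2 / (3 / 4 * (2 - q)) = 2 * (cq / 3).
    by rewrite -[RHS](mulfK (lt0r_neq0 lam0)); congr (_ / _); rewrite /cq; lra.
  have := mulr_ge0 (_ : 0 <= 1 - 3 / 4 * (2 - q)) (D0 m (le1 m mN)).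
  move=> /(_ ltac:(lra)) h1.
  have : \sum_(2 <= j < m) kstep t j * sstep t j * `|dbar t U j| ^+ 2
      <= q / 2 * \sum_(2 <= j < m) D j.
    rewrite mulr_sumr; apply: ler_sum_nat => j /andP[j2 jm].
    have /andP[_ mN'] := mN.
    have jN : (2 <= j <= N)%N by rewrite j2 (leq_trans (ltnW jm)).
    have [_ s1 _] := sbnd j jN.
    by have := ler_wpM2r (D0 j (le1 j jN)) s1; rewrite /D; lra.
  have := e0 m; lra.

(* Gronwall argument *)
have /andP[n2 nN] := n_range.
pose a j := cq * (gamma (t j) ^+ 2 * kstep t j).
pose Phi := \sum_(2 <= j < n.+1) kstep t j * `|f (t j)| ^+ 2 + I0 + e 1%N.
(* The data part of the sum of [emax] and [dissip], whose factors [cq / 3] and [2 cq / 3] add up to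
   [cq]. *)
pose F := 2 * e 1%N + I0 + cq * \sum_(2 <= j < n.+1) kstep t j * `|f (t j)| ^+ 2.
have sumf0 : 0 <= \sum_(2 <= j < n.+1) kstep t j * `|f (t j)| ^+ 2.
  rewrite big_nat sumr_ge0// => j /andP[j2 jn].
  by rewrite mulr_ge0 ?sqr_ge0// ltW// k_gt0// (ltnW j2) (leq_trans _ nN).
have F0 : 0 <= F.
  by have := mulr_ge0 (ltW cq0) sumf0; have := e0 1%N; rewrite /F; lra.
have FPhi : F <= cq * Phi by rewrite /F /Phi /cq; have := e0 1%N; nra.
have sumcE m : cq * \sum_(2 <= j < m.+1) c j =
    cq * \sum_(2 <= j < m.+1) kstep t j * `|f (t j)| ^+ 2
    + \sum_(2 <= j < m.+1) a j * e j.
  rewrite !mulr_sumr -big_split/=; apply: eq_bigr => j _.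
  by rewrite /c /a; ring.
have gronwall : F + \sum_(2 <= j < n.+1) a j * e j
    <= F * expR ((1 - c1)^-1 * \sum_(2 <= j < n.+1) a j).
  apply: discrete_gronwall => //; first by rewrite ltnW.
  - by case/andP: c1_bounds.
  - move=> j /andP[j2 jn].
    have jN : (2 <= j <= N)%N by rewrite j2 (leq_trans _ nN).
    have kj := k_gt0 j (le1 j jN).
    rewrite (mulr_ge0 (ltW cq0) (mulr_ge0 (sqr_ge0 _) (ltW kj)))/=.
    apply: le_trans kmax_small; rewrite -mulrA ler_wpM2l ?(ltW cq0)//.
    apply: (ler_pM (sqr_ge0 _) (ltW kj) (gmaxE j (le1 j jN))).
    by apply: le_bigmax_seq => //; rewrite mem_index_iota.
  - move=> j /andP[j2 jn].
    have jN : (2 <= j <= N)%N by rewrite j2 (leq_trans _ nN).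
    (* [cq / 3] is enlarged to [cq] and the sum of [f] extended up to [n], so that one [F] serves
       all [j]. *)
    have := emax j jN; have := sumcE j; have := sumc0 j jN.
    have sumfj : \sum_(2 <= i < j.+1) kstep t i * `|f (t i)| ^+ 2
        <= \sum_(2 <= i < n.+1) kstep t i * `|f (t i)| ^+ 2.
      apply: ler_sum_natr => // i /andP[i2 iN].
      by rewrite mulr_ge0 ?sqr_ge0// ltW// k_gt0// (ltnW i2) (leq_trans _ nN).
    move=> h1 h2 h3; have h4 := ler_wpM2l (ltW cq0) sumfj.
    have h5 := mulr_ge0 (ltW cq0) h1; have := e0 1%N.
    rewrite /F; lra.
have /andP[c10 c11] := c1_bounds; have c1' : 0 < 1 - c1 by lra.
have cqc1 : 0 <= cq / (1 - c1) by rewrite divr_ge0 ?ltW.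
split; last first.
  rewrite /C1 -/q -/cq ler_wpM2l// ler_expR ler_wpM2l//.
  apply: (@le_trans _ _ (\sum_(2 <= j < n.+1) gmax ^+ 2 * kstep t j)).
    apply: ler_sum_nat => j /andP[j2 jn].
    have jN : (1 <= j <= N)%N by rewrite (ltnW j2) (leq_trans _ nN).
    by rewrite ler_wpM2r ?gmaxE// ltW// k_gt0.
  (* The steps from index 2 on telescope to [t n - t 1], and [t 1 > 0]. *)
  rewrite -mulr_sumr ler_wpM2l ?sqr_ge0// big_add1/= /kstep/=.
  rewrite telescope_sumr ?(ltnW n2)// gerBl ltW//.
  by have /andP[] : 0 < t 1%N <= T by rewrite tT// (leq_trans _ N_ge2).

(* Assembling the three norms *)
have linf : norm_linfV S U 2 n ^+ 2
    <= e 1%N + I0 / 2 + cq / 3 * \sum_(2 <= j < n.+1) c j.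
  apply: bigmax_sqr_le => [|j _|j /andP[j2 jn]]; first 2 last.
  - have jN : (2 <= j <= N)%N by rewrite j2 (leq_trans _ nN).
    apply: le_trans (emax j jN) _.
    rewrite lerD2l ler_wpM2l ?divr_ge0 ?(ltW cq0)//.
    apply: ler_sum_natr => // i /andP[i2 iN].
    by rewrite c0// (ltnW i2) (leq_trans _ nN).
  - exact: le_trans (e0 n) (emax n n_range).
  - exact: normr_ge0.
have l2 : norm_l2HH t U 2 n ^+ 2
    = \sum_(2 <= j < n) kstep t j * sstep t j * `|dbar t U j| ^+ 2.
  rewrite sqr_sqrtr// big_nat sumr_ge0// => j /andP[j2 jn].
  have jN : (2 <= j <= N)%N by rewrite j2 (leq_trans (ltnW jn)).
  have [s0 _ _] := sbnd j jN.
  by rewrite mulr_ge0 ?sqr_ge0// mulr_ge0// ltW// k_gt0// le1.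
have C1E : C1 gamma t c1 n
    = cq / (1 - c1) * expR ((1 - c1)^-1 * \sum_(2 <= j < n.+1) a j).
  by rewrite /C1 -/q -/cq /a -mulr_sumr; congr (_ * expR _); ring.
have Phi0 : 0 <= Phi by rewrite /Phi; have := e0 1%N; lra.
apply: (@le_trans _ _ (F + \sum_(2 <= j < n.+1) a j * e j)).
  have := dissip n n_range; have := sumcE n; rewrite -/(D n) l2 /F; lra.
apply: le_trans gronwall _; rewrite C1E -/(e 1%N) -/I0 -/Phi mulrAC.
apply: ler_wpM2r; first exact: expR_ge0.
apply: le_trans FPhi _; apply: ler_wpM2r => //.
by rewrite ler_pdivlMr//; have := mulr_ge0 (ltW cq0) (ltW c10); lra.
Qed.
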